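(* Let $A(\mathbb Q)$ be a quaternion algebra over $\mathbb Q$ such that $A(\mathbb R)=A(\mathbb Q)\otimes_{\mathbb Q}\mathbb R$ is isomorphic to Hamilton's quaternion algebra $\mathbb H$, let $\mathcal O'$ be an order of $A(\mathbb Q)$, let $\mathcal I'$ be a non-zero two-sided ideal of $\mathcal O'$, and let $N$ be the reduced norm on $A(\mathbb R)$. For every $x\in A(\mathbb R)-A(\mathbb Q)$, let $$c(x)=\liminf N(q)\,N(x-pq^{-1})^{1/2},$$ the lower limit being taken over the pairs $(p,q)\in\mathcal O'\times\mathcal I'$ for which there exist $r,s\in\mathcal O'$ with $N(qr-qpq^{-1}s)=1$, as $N(q)\to\infty$. Then the set of real numbers of the form $c(x)$ for $x\in A(\mathbb R)-A(\mathbb Q)$ (the Hamilton–Lagrange spectrum) contains the interval $[0,0.0337]$.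
   Context: An order of $A(\mathbb Q)$ is a unitary subring which is a finitely generated $\mathbb Z$-module generating $A(\mathbb Q)$ as a $\mathbb Q$-vector space. For $z=x_1+x_2i+x_3j+x_4k\in\mathbb H$, $N(z)=z\bar z=x_1^2+x_2^2+x_3^2+x_4^2$. *)

(* Defs.v *)
From Stdlib Require List.
From mathcomp Require Import all_boot all_order all_algebra.
From mathcomp Require Import classical_sets reals constructive_ereal ereal.
Set Implicit Arguments. Unset Strict Implicit. Unset Printing Implicit Defensive.
Import Order.TTheory GRing.Theory Num.Theory.
Local Open Scope ring_scope.
Local Open Scope classical_set_scope.

(* Hamilton's quaternions H over a real field R: x1 + x2 i + x3 j + x4 k. *)
Record quat (R : Type) := Quat { qx1 : R; qx2 : R; qx3 : R; qx4 : R }.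

Section Quat.
Variable R : realType.

Definition qzero : quat R := Quat 0 0 0 0.
Definition qone : quat R := Quat 1 0 0 0.
Definition qadd (x y : quat R) : quat R :=
  Quat (qx1 x + qx1 y) (qx2 x + qx2 y) (qx3 x + qx3 y) (qx4 x + qx4 y).
Definition qopp (x : quat R) : quat R := Quat (- qx1 x) (- qx2 x) (- qx3 x) (- qx4 x).
Definition qsub (x y : quat R) : quat R := qadd x (qopp y).
Definition qscale (r : R) (x : quat R) : quat R :=
  Quat (r * qx1 x) (r * qx2 x) (r * qx3 x) (r * qx4 x).
(* Hamilton product: i^2 = j^2 = k^2 = ijk = -1 *)
Definition qmul (x y : quat R) : quat R :=
  Quat (qx1 x * qx1 y - qx2 x * qx2 y - qx3 x * qx3 y - qx4 x * qx4 y)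
       (qx1 x * qx2 y + qx2 x * qx1 y + qx3 x * qx4 y - qx4 x * qx3 y)
       (qx1 x * qx3 y - qx2 x * qx4 y + qx3 x * qx1 y + qx4 x * qx2 y)
       (qx1 x * qx4 y + qx2 x * qx3 y - qx3 x * qx2 y + qx4 x * qx1 y).
Definition qconj (x : quat R) : quat R := Quat (qx1 x) (- qx2 x) (- qx3 x) (- qx4 x).
Definition qnorm (x : quat R) : R := qx1 x ^+ 2 + qx2 x ^+ 2 + qx3 x ^+ 2 + qx4 x ^+ 2.
(* inverse conj(z) / N(z) (only used for z <> 0) *)
Definition qinv (x : quat R) : quat R := qscale (qnorm x)^-1 (qconj x).

Definition QA (e0 e1 e2 e3 : quat R) : set (quat R) :=
  [set x | exists c0 c1 c2 c3 : rat,
     x = qadd (qscale (ratr c0) e0) (qadd (qscale (ratr c1) e1)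
           (qadd (qscale (ratr c2) e2) (qscale (ratr c3) e3)))].

(* e0..e3 span a 4-dimensional Q-subalgebra of H (with unit) whose
   extension of scalars to R is all of H, i.e. e0..e3 are R-linearly
   independent; this is a quaternion algebra A(Q) with A(R) = H. *)
Definition definite_quat_alg (e0 e1 e2 e3 : quat R) : Prop :=
  [/\ QA e0 e1 e2 e3 qone,
      (forall x y, QA e0 e1 e2 e3 x -> QA e0 e1 e2 e3 y ->
                   QA e0 e1 e2 e3 (qmul x y)) &
      (forall r0 r1 r2 r3 : R,
         qadd (qscale r0 e0) (qadd (qscale r1 e1)
           (qadd (qscale r2 e2) (qscale r3 e3))) = qzero ->
         [/\ r0 = 0, r1 = 0, r2 = 0 & r3 = 0])].

Definition zcomb (l : seq (int * quat R)) : quat R :=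
  foldr (fun p acc => qadd (qscale (p.1)%:~R p.2) acc) qzero l.
Definition qcomb (l : seq (rat * quat R)) : quat R :=
  foldr (fun p acc => qadd (qscale (ratr p.1) p.2) acc) qzero l.

Definition is_order (AQ O : set (quat R)) : Prop :=
  O `<=` AQ /\
      O qone /\
      (forall x y, O x -> O y -> O (qadd x y)) /\
      (forall x, O x -> O (qopp x)) /\
      (forall x y, O x -> O y -> O (qmul x y)) /\
      (exists gens : seq (quat R),
         forall x, O x <-> exists cs : seq int, size cs = size gens /\
                                              x = zcomb (zip cs gens)) /\
      (forall x, AQ x -> exists l : seq (rat * quat R),
                   (forall p, List.In p l -> O p.2) /\ x = qcomb l).

Definition is_nz_twosided_ideal (O I : set (quat R)) : Prop :=
  I `<=` O /\
      I qzero /\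
      (forall x y, I x -> I y -> I (qadd x y)) /\
      (forall x, I x -> I (qopp x)) /\
      (forall a x, O a -> I x -> I (qmul a x) /\ I (qmul x a)) /\
      (exists x, I x /\ x <> qzero).

Definition admissible (O I : set (quat R)) (p q : quat R) : Prop :=
  [/\ O p, I q &
      exists r s, O r /\ O s /\
        qnorm (qsub (qmul q r) (qmul (qmul (qmul q p) (qinv q)) s)) = 1].

(* c(x) = liminf_{N(q) -> oo} N(q) N(x - p q^-1)^(1/2), over admissible (p,q):
   sup over M of inf over admissible pairs with N(q) >= M (value in \bar R). *)
Definition cval (O I : set (quat R)) (x : quat R) : \bar R :=
  ereal_sup [set y | exists M : R,
    y = ereal_inf [set z | exists p q, admissible O I p q /\ M <= qnorm q /\
          z = (qnorm q * Num.sqrt (qnorm (qsub x (qmul p (qinv q)))))%:E]].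

End Quat.

(* Main.v *)
(* A point a = p q^-1 with (p, q) admissible carries the weight d_a = N(q)^-1.
   Inverting the matrix with first column (p, q) and using that non-zero elements
   of the order have norm at least 1 gives |a - b|^2 >= d_a d_b for distinct
   points; the points of A(Q) are similarly badly approximable, and the fractions
   (1 + m o) / m^k with o in the order are dense.
   It remains to find x with |x - a| > t d_a for all a and |x - a| <= (t + e) d_a
   infinitely often for every e > 0. Start from a whose weight is maximal
   near it, and shrink a ball by thirds along a circle on the sphere
   |z - a| = t d_a: by the separation at most one ball B(b, t d_b) of the relevant
   size interferes at each step, and rotating away from b avoids it. Once the ball
   is much smaller than e d_a, a point a' of maximal weight in its outer half is
   again isolated from all balls of larger weight, lies at distance between
   t d_a and (t + e) d_a from a, and the construction is iterated from a'. *)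
Require Import Defs.
From mathcomp Require Import all_boot all_order all_algebra.
From mathcomp Require Import boolp classical_sets reals constructive_ereal ereal.
From mathcomp Require Import ring lra.
Import Order.TTheory GRing.Theory Num.Theory.
Local Open Scope ring_scope.
Local Open Scope classical_set_scope.

(** * Quaternions and their norm *)

Section Quaternions.
Context {R : realType}.
Implicit Types (x y z : quat R) (b c : R).

Definition qdot x y : R :=
  qx1 x * qx1 y + qx2 x * qx2 y + qx3 x * qx3 y + qx4 x * qx4 y.

Definition qdist x y : R := Num.sqrt (qnorm (qsub x y)).

Lemma quatP x y : qx1 x = qx1 y -> qx2 x = qx2 y -> qx3 x = qx3 y ->
  qx4 x = qx4 y -> x = y.
Proof. by case: x => ? ? ? ?; case: y => ? ? ? ? /= -> -> -> ->. Qed.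

Ltac quat_ring := apply: quatP => /=; ring.

Lemma qmulA x y z : qmul x (qmul y z) = qmul (qmul x y) z.
Proof. quat_ring. Qed.

Lemma qmulq1 x : qmul x (qone R) = x.
Proof. quat_ring. Qed.

Lemma qmulDl x y z : qmul (qadd x y) z = qadd (qmul x z) (qmul y z).
Proof. quat_ring. Qed.

Lemma qmulZl c x y : qmul (qscale c x) y = qscale c (qmul x y).
Proof. quat_ring. Qed.

Lemma qmulZr c x y : qmul x (qscale c y) = qscale c (qmul x y).
Proof. quat_ring. Qed.

Lemma qscaleA b c x : qscale b (qscale c x) = qscale (b * c) x.
Proof. quat_ring. Qed.

Lemma qscale1 x : qscale 1 x = x.
Proof. quat_ring. Qed.

Lemma qscale0 x : qscale 0 x = qzero R.
Proof. quat_ring. Qed.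

Lemma qmulC x : qmul (qconj x) x = qscale (qnorm x) (qone R).
Proof. by apply: quatP; rewrite /qnorm /=; ring. Qed.

Lemma qmulxC x : qmul x (qconj x) = qscale (qnorm x) (qone R).
Proof. by apply: quatP; rewrite /qnorm /=; ring. Qed.

Lemma qnormM x y : qnorm (qmul x y) = qnorm x * qnorm y.
Proof. rewrite /qnorm /=; ring. Qed.

Lemma qnormZ c x : qnorm (qscale c x) = c ^+ 2 * qnorm x.
Proof. rewrite /qnorm /=; ring. Qed.

Lemma qnorm1 : qnorm (qone R) = 1.
Proof. rewrite /qnorm /=; ring. Qed.

Lemma qnorm0 : qnorm (qzero R) = 0.
Proof. rewrite /qnorm /=; ring. Qed.

Lemma qnorm_ge0 x : 0 <= qnorm x.
Proof. by rewrite /qnorm !addr_ge0 ?sqr_ge0. Qed.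

Lemma qnorm_eq0 x : qnorm x = 0 -> x = qzero R.
Proof.
move=> /eqP; rewrite /qnorm !paddr_eq0 ?addr_ge0 ?sqr_ge0 // !sqrf_eq0.
by move=> /andP[/andP[/andP[/eqP ? /eqP ?] /eqP ?] /eqP ?]; apply: quatP.
Qed.

Lemma qnorm_gt0 x : x <> qzero R -> 0 < qnorm x.
Proof. by move=> xn0; rewrite lt0r qnorm_ge0 andbT; apply/eqP => /qnorm_eq0. Qed.

Lemma qmulV x : qnorm x != 0 -> qmul x (qinv x) = qone R.
Proof. by move=> x0; rewrite qmulZr qmulxC qscaleA mulVf // qscale1. Qed.

Lemma qmulVx x : qnorm x != 0 -> qmul (qinv x) x = qone R.
Proof. by move=> x0; rewrite qmulZl qmulC qscaleA mulVf // qscale1. Qed.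

Lemma qdist_ge0 x y : 0 <= qdist x y.
Proof. exact: sqrtr_ge0. Qed.

Lemma qdist_sq x y : qdist x y ^+ 2 = qnorm (qsub x y).
Proof. by rewrite sqr_sqrtr ?qnorm_ge0. Qed.

Lemma qdistC x y : qdist x y = qdist y x.
Proof. by congr (Num.sqrt _); rewrite /qnorm /=; ring. Qed.

Lemma qdistxx x : qdist x x = 0.
Proof. by rewrite /qdist (_ : qnorm _ = 0) ?sqrtr0 // /qnorm /=; ring. Qed.

Lemma qdist_eq0 x y : qdist x y = 0 -> x = y.
Proof.
move=> d0; have /qnorm_eq0 : qnorm (qsub x y) = 0 by rewrite -qdist_sq d0 expr0n.
by case: x y {d0} => ? ? ? ? [? ? ? ?] [] /= /subr0_eq -> /subr0_eq -> /subr0_eq ->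
  /subr0_eq ->.
Qed.

Lemma qdot_le x y : qdot x y <= Num.sqrt (qnorm x) * Num.sqrt (qnorm y).
Proof.
rewrite -sqrtrM ?qnorm_ge0 //; apply: (le_trans (ler_norm _)).
rewrite -sqrtr_sqr; apply: ler_wsqrtr; rewrite -subr_ge0.
(* Lagrange's identity: the defect in the Cauchy-Schwarz inequality is the sum of the squared 2 x 2
   minors. *)
rewrite [leRHS](_ : _ =
  (qx1 x * qx2 y - qx2 x * qx1 y) ^+ 2 + (qx1 x * qx3 y - qx3 x * qx1 y) ^+ 2 +
  (qx1 x * qx4 y - qx4 x * qx1 y) ^+ 2 + (qx2 x * qx3 y - qx3 x * qx2 y) ^+ 2 +
  (qx2 x * qx4 y - qx4 x * qx2 y) ^+ 2 + (qx3 x * qx4 y - qx4 x * qx3 y) ^+ 2).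
  by rewrite !addr_ge0 ?sqr_ge0.
by rewrite /qnorm /qdot; ring.
Qed.

Lemma qdist_triangle y x z : qdist x z <= qdist x y + qdist y z.
Proof.
rewrite -(@ler_pXn2r _ 2) ?nnegrE ?addr_ge0 ?qdist_ge0 //.
rewrite sqrrD !qdist_sq.
have := qdot_le (qsub x y) (qsub y z); rewrite -/(qdist _ _) -/(qdist _ _) => H.
rewrite (_ : qnorm (qsub x z) = qnorm (qsub x y) + qnorm (qsub y z)
  + qdot (qsub x y) (qsub y z) *+ 2); last by rewrite /qnorm /qdot /=; ring.
by rewrite addrAC lerD2r lerD2l lerMn2r H.
Qed.

Lemma qdist_le_l1 x y : qdist x y <= `|qx1 x - qx1 y| + `|qx2 x - qx2 y|
  + `|qx3 x - qx3 y| + `|qx4 x - qx4 y|.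
Proof.
rewrite -(@ler_pXn2r _ 2) ?nnegrE ?addr_ge0 ?qdist_ge0 //.
rewrite qdist_sq /qnorm /=.
have S (u : R) : u ^+ 2 = `|u| ^+ 2 by rewrite real_normK ?num_real.
rewrite (S (qx1 x - _)) (S (qx2 x - _)) (S (qx3 x - _)) (S (qx4 x - _)).
move: (normr_ge0 (qx1 x - qx1 y)) (normr_ge0 (qx2 x - qx2 y))
  (normr_ge0 (qx3 x - qx3 y)) (normr_ge0 (qx4 x - qx4 y)).
move: `|_| `|_| `|_| `|_| => p q r s p0 q0 r0 s0.
have := mulr_ge0 p0 q0; have := mulr_ge0 p0 r0; have := mulr_ge0 p0 s0.
have := mulr_ge0 q0 r0; have := mulr_ge0 q0 s0; have := mulr_ge0 r0 s0.
nra.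
Qed.

End Quaternions.

(** * Approximation with a prescribed constant *)

Section Rotation.
Context {R : realType}.

(** The step v = z' - z has length close to 2r/3, and with w = b - z one has |z' - b|^2 = |w|^2 +
    |v|^2 - 2 v.w. The sense of the rotation makes the tangential part of v.w nonpositive, and r <=
    rho / 10 makes its radial part small against r^2. *)
Lemma rotate_away (z c b : quat R) (rho r t : R) :
  0 < rho -> 0 < r -> r <= rho / 10%:R -> 0 <= t <= 2%:R / 59%:R ->
  qdist z c = rho -> qdist z b <= (1 + 7%:R * t) * r ->
  exists z', [/\ qdist z' c = rho, qdist z z' <= 2%:R / 3%:R * r &
    (7%:R * t + 1 / 3%:R) * r <= qdist z' b].
Proof.
move=> rho0 r0 rrho /andP[t0 t1] zc zb.
pose m := qsub z c; pose w := qsub b z.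
(* The product i m: orthogonal to [m] and of the same norm, hence tangent to the sphere at [z]. *)
pose im := Quat (- qx2 m) (qx1 m) (- qx4 m) (qx3 m).
pose s : R := if 0 <= qdot im w then -1 else 1.
have s2 : s ^+ 2 = 1 by rewrite /s; case: ifP => _; ring.
have sw : s * qdot im w <= 0.
  rewrite /s; case: ifP => [w0|/negbT]; first by rewrite mulN1r oppr_le0.
  by rewrite -ltNge mul1r => /ltW.
(* The tangent of half the angle of rotation; the chord is then 2 u rho sqrt(k) = (2/3) r sqrt(k),
   where k = 1 / (1 + u^2). *)
pose u : R := r / (3%:R * rho).
have u0 : 0 < u by rewrite /u divr_gt0 ?mulr_gt0.
have ur : u * rho = r / 3%:R by rewrite /u; field; rewrite gt_eqF.
have u1 : u <= 1 / 30%:R.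
  by rewrite /u ler_pdivrMr ?mulr_gt0 //; lra.
pose k : R := (1 + u ^+ 2)^-1.
have ku : k * (1 + u ^+ 2) = 1.
  by rewrite mulVf // gt_eqF // ltr_pwDl ?sqr_ge0.
have k0 : 0 < k by rewrite invr_gt0 ltr_pwDl ?sqr_ge0.
have mrho : qnorm m = rho ^+ 2 by rewrite -zc qdist_sq.
have imrho : qnorm im = rho ^+ 2 by rewrite -mrho /qnorm /=; ring.
have mim : qdot m im = 0 by rewrite /qdot /=; ring.
(* rational parametrisation of the circle through [z] spanned by [m] and [im] *)
pose v := qadd (qscale (- 2%:R * u ^+ 2 * k) m) (qscale (2%:R * u * s * k) im).
have vv : qnorm v = 4%:R * u ^+ 2 * k * rho ^+ 2.
  have -> : qnorm v = (2%:R * u ^+ 2 * k) ^+ 2 * qnorm m +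
    (2%:R * u * k) ^+ 2 * s ^+ 2 * qnorm im
    - 8%:R * u ^+ 3 * k ^+ 2 * s * qdot m im by rewrite /qnorm /qdot /=; ring.
  rewrite mim s2 imrho mrho.
  have -> : 4%:R * u ^+ 2 * k * rho ^+ 2 =
     4%:R * u ^+ 2 * k * rho ^+ 2 * (k * (1 + u ^+ 2)) by rewrite ku mulr1.
  ring.
have vm : qdot v m = - 2%:R * u ^+ 2 * k * rho ^+ 2.
  have -> : qdot v m = - 2%:R * u ^+ 2 * k * qnorm m +
    (2%:R * u * s * k) * qdot m im by rewrite /qnorm /qdot /=; ring.
  by rewrite mim mrho mulr0 addr0.
have vr : qnorm v = 4%:R / 9%:R * r ^+ 2 * k.
  have -> : qnorm v = 4%:R * (u * rho) ^+ 2 * k by rewrite vv; ring.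
  by rewrite ur; field.
have k1 : k <= 1.
  by rewrite -ku ler_pMr // lerDl sqr_ge0.
have k2 : 1 - 1 / 30%:R <= k.
  have : u ^+ 2 <= u * (1 / 30%:R) by rewrite expr2 ler_pM2l.
  have : k * u ^+ 2 <= 1 * u ^+ 2 by rewrite ler_wpM2r ?sqr_ge0.
  by move: ku u1 u0; rewrite mulrDr mulr1; lra.
exists (qadd z v); split.
- have -> : qdist (qadd z v) c = Num.sqrt (rho ^+ 2).
    congr (Num.sqrt _).
    have -> : qnorm (qsub (qadd z v) c) = qnorm m + qnorm v + 2%:R * qdot v m.
      by rewrite /m /qnorm /qdot /=; ring.
    by rewrite vv vm mrho; ring.
  by rewrite sqrtr_sqr gtr0_norm.
- rewrite -(@ler_pXn2r _ 2) ?nnegrE ?qdist_ge0 //; last by rewrite mulr_ge0 ?ltW.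
  rewrite qdist_sq (_ : qnorm _ = qnorm v); last by rewrite /qnorm /=; ring.
  rewrite vr exprMn.
  have -> : 4%:R / 9%:R * r ^+ 2 * k = (2%:R / 3%:R) ^+ 2 * r ^+ 2 * k by field.
  by rewrite ler_piMr // mulr_ge0 // sqr_ge0.
- rewrite -(@ler_pXn2r _ 2) ?nnegrE ?qdist_ge0 //; last first.
    by rewrite mulr_ge0 ?(ltW r0) // addr_ge0 ?mulr_ge0.
  rewrite qdist_sq.
  have -> : qnorm (qsub (qadd z v) b) = qnorm w + qnorm v - 2%:R * qdot v w.
    by rewrite /w /qnorm /qdot /=; ring.
  have -> : qdot v w = - 2%:R * u ^+ 2 * k * qdot m w + 2%:R * u * k * (s * qdot im w).
    by rewrite /qdot /v /=; ring.
  have mw : - (rho * ((1 + 7%:R * t) * r)) <= qdot m w.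
    have := qdot_le (qsub c z) w.
    rewrite -/(qdist c z) -/(qdist b z) qdistC zc qdistC => mw.
    rewrite lerNl (_ : - qdot m w = qdot (qsub c z) w); last by rewrite /qdot /=; ring.
    by apply: le_trans mw _; rewrite ler_pM2l.
  have umw : - (1 / 90%:R * (1 + 7%:R * t) * r ^+ 2) <= u ^+ 2 * qdot m w.
    have h1 : u ^+ 2 * - (rho * ((1 + 7%:R * t) * r)) <= u ^+ 2 * qdot m w.
      by rewrite ler_pM2l ?exprn_gt0.
    apply: le_trans h1.
    have -> : u ^+ 2 * - (rho * ((1 + 7%:R * t) * r)) =
      - (u * (1 + 7%:R * t) * r * (u * rho)) by ring.
    rewrite ur lerN2.
    have h2 : u * ((1 + 7%:R * t) * r * (r / 3%:R)) <=
      1 / 30%:R * ((1 + 7%:R * t) * r * (r / 3%:R)).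
      apply: ler_wpM2r => //.
      have r00 := ltW r0.
      by rewrite !mulr_ge0 ?addr_ge0 ?mulr_ge0.
    have e1 : u * (1 + 7%:R * t) * r * (r / 3%:R) =
      u * ((1 + 7%:R * t) * r * (r / 3%:R)) by ring.
    have e2 : 1 / 90%:R * (1 + 7%:R * t) * r ^+ 2 =
      1 / 30%:R * ((1 + 7%:R * t) * r * (r / 3%:R)) by field.
    by rewrite e1 e2.
  have w0 := qnorm_ge0 w.
  have r2 : 0 < r ^+ 2 by rewrite exprn_gt0.
  have su : u * k * (s * qdot im w) <= 0.
    by rewrite mulr_ge0_le0 // mulr_ge0 // ltW.
  have kmw : - (1 / 90%:R * (1 + 7%:R * t) * r ^+ 2) <= k * (u ^+ 2 * qdot m w).
    have [p|n] := leP 0 (u ^+ 2 * qdot m w).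
      have p' : 0 <= k * (u ^+ 2 * qdot m w) by rewrite mulr_ge0 // ltW.
      apply: le_trans p'; rewrite oppr_le0 mulr_ge0 ?sqr_ge0 //.
      by rewrite mulr_ge0 // addr_ge0 ?mulr_ge0.
    apply: le_trans umw _; rewrite -subr_ge0.
    have -> : k * (u ^+ 2 * qdot m w) - u ^+ 2 * qdot m w =
       (1 - k) * - (u ^+ 2 * qdot m w) by ring.
    by rewrite mulr_ge0 ?subr_ge0 // oppr_ge0 ltW.
  (* The bound on t gives 7t + 1/3 <= 101/177 < 4/7. *)
  have tr : ((7%:R * t + 1 / 3%:R) * r) ^+ 2 <= (4%:R / 7%:R) ^+ 2 * r ^+ 2.
    rewrite exprMn ler_pM2r // ler_pXn2r ?nnegrE //; lra.
  have kr : (1 - 1 / 30%:R) * r ^+ 2 <= k * r ^+ 2 by rewrite ler_pM2r.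
  have trr : t * r ^+ 2 <= 2%:R / 59%:R * r ^+ 2 by rewrite ler_pM2r.
  rewrite vr; move: tr umw kmw trr su w0 r2 kr.
  set X := r ^+ 2; set Y := u * k * _; set Z := qnorm w.
  set A := ((7%:R * t + 1 / 3%:R) * r) ^+ 2.
  have -> : - 2%:R * u ^+ 2 * k * qdot m w = - 2%:R * (k * (u ^+ 2 * qdot m w)) by ring.
  have -> : 2%:R * u * k * (s * qdot im w) = 2%:R * Y by rewrite /Y; ring.
  set W := k * (u ^+ 2 * _).
  have -> : 1 / 90%:R * (1 + 7%:R * t) * X = 1 / 90%:R * (X + 7%:R * (t * X)) by ring.
  have -> : 4%:R / 9%:R * X * k = 4%:R / 9%:R * (k * X) by ring.
  lra.
Qed.

End Rotation.

(** * Limits of nested balls *)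

Section NestedBalls.
Context {R : realType}.

(** Every left endpoint lies below every right endpoint, so the supremum of the left endpoints is in
    all the intervals. *)
Lemma nested_intervals (f rho : nat -> R) :
  (forall n, `|f n.+1 - f n| + rho n.+1 <= rho n) -> (forall n, 0 <= rho n) ->
  exists x, forall n, `|x - f n| <= rho n.
Proof.
move=> frho rho0.
have far n k : `|f (n + k)%N - f n| + rho (n + k)%N <= rho n.
  elim: k => [|k IH]; first by rewrite addn0 subrr normr0 add0r.
  rewrite addnS; apply: le_trans IH.
  have := frho (n + k)%N; have := ler_distD (f (n + k)%N) (f (n + k).+1) (f n).
  lra.
have lohi m n : f m - rho m <= f n + rho n.
  have [/subnKC e|/ltnW/subnKC e] := leqP m n.
  - have := far m (n - m)%N; rewrite e => h.
    have := ler_norm (f m - f n); rewrite distrC; have := rho0 n; lra.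
  - have := far n (m - n)%N; rewrite e => h.
    have := ler_norm (f m - f n); have := rho0 m; lra.
pose E := [set y | exists n, y = f n - rho n].
have ubE n : ubound E (f n + rho n) by move=> _ [m ->]; exact: lohi.
have E0 : E !=set0 by exists (f 0%N - rho 0%N); exists 0%N.
exists (sup E) => n; rewrite ler_norml; apply/andP; split.
- rewrite lerBrDl; apply: ub_le_sup; first by exists (f 0%N + rho 0%N); exact: ubE.
  by exists n; ring.
- by rewrite lerBlDl; apply: ge_sup.
Qed.

(** Works coordinate by coordinate. The factor 4 comes from the sum of four coordinate bounds; it is
    harmless because the radii tend to 0 in the application. *)
Lemma nested_balls (c : nat -> quat R) (rho : nat -> R) :
  (forall n, qdist (c n.+1) (c n) + rho n.+1 <= rho n) -> (forall n, 0 <= rho n) ->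
  exists x, forall n, qdist x (c n) <= 4%:R * rho n.
Proof.
move=> crho rho0.
have coord (p : quat R -> R) :
    (forall x y, (p x - p y) ^+ 2 <= qnorm (qsub x y)) ->
    exists x, forall n, `|x - p (c n)| <= rho n.
  move=> pq; apply: nested_intervals => // n; apply: le_trans (crho n).
  rewrite lerD2r -(@ler_pXn2r _ 2) ?nnegrE ?qdist_ge0 // qdist_sq.
  by rewrite real_normK ?num_real.
have [|x1 h1] := coord (@qx1 R); first by move=> x y; rewrite /qnorm /=;
  rewrite -!addrA lerDl !addr_ge0 ?sqr_ge0.
have [|x2 h2] := coord (@qx2 R); first by move=> x y; rewrite /qnorm /=;
  rewrite -!addrA addrCA lerDl !addr_ge0 ?sqr_ge0.
have [|x3 h3] := coord (@qx3 R); first by move=> x y; rewrite /qnorm /=;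
  rewrite addrAC lerDr !addr_ge0 ?sqr_ge0.
have [|x4 h4] := coord (@qx4 R); first by move=> x y; rewrite /qnorm /=;
  rewrite lerDr !addr_ge0 ?sqr_ge0.
exists (Quat x1 x2 x3 x4) => n; apply: le_trans (qdist_le_l1 _ _) _ => /=.
by move: (h1 n) (h2 n) (h3 n) (h4 n); lra.
Qed.

End NestedBalls.

Lemma geometric_lt {R : realType} (r e : R) (k : nat) : (1 < k)%N -> 0 < e ->
  exists n, r / k%:R ^+ n < e.
Proof.
move=> k1 e0; exists (Num.bound (`|r| / e)); set n := Num.bound _.
rewrite ltr_pdivrMr; last by rewrite exprn_gt0 // ltr0n (ltn_trans _ k1).
rewrite mulrC -ltr_pdivrMr //; apply: (@lt_trans _ _ n%:R); last first.
  by rewrite -natrX ltr_nat ltn_expl.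
have : 0 <= `|r| / e by rewrite divr_ge0 // ltW.
move=> /archi_boundP; apply: le_lt_trans.
by rewrite ler_pM2r ?invr_gt0 // ler_norm.
Qed.

(** Two centres of weights u and v at distance D, whose balls both come within r of one point, would
    contradict the separation D^2 >= u v. With s = u + v, the product u v is at least (7r/3) s - 49
    r^2 / 9, while the bound (2r + 2s/59)^2 for D^2 is convex in s; so it is enough to compare at s
    = 14r/3 and s = 14r. *)
Lemma comparable_far {R : realType} (r t u v D : R) : 0 < r -> 0 <= t <= 2%:R / 59%:R ->
  7%:R * r / 3%:R <= u <= 7%:R * r -> 7%:R * r / 3%:R <= v <= 7%:R * r ->
  0 <= D <= 2%:R * r + t * (u + v) -> D ^+ 2 < u * v.
Proof.
move=> r0 /andP[t0 t1] /andP[u0 u1] /andP[v0 v1] /andP[D0 D1].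
pose s := u + v; pose B := 2%:R * r + 2%:R / 59%:R * s.
have DB : D <= B.
  apply: (le_trans D1); rewrite lerD2l ler_wpM2r //; lra.
have DB2 : D ^+ 2 <= B ^+ 2 by rewrite ler_pXn2r ?nnegrE // (le_trans D0).
apply: (le_lt_trans DB2).
have h1 : 0 <= (u - 7%:R * r / 3%:R) * (v - 7%:R * r / 3%:R).
  by rewrite mulr_ge0 ?subr_ge0.
have h2 : 0 <= (s - 14%:R / 3%:R * r) * (14%:R * r - s).
  by apply: mulr_ge0; rewrite subr_ge0 /s; lra.
have h3 : 0 <= r * (s - 14%:R / 3%:R * r).
  by rewrite mulr_ge0 ?subr_ge0 ?(ltW r0) // /s; lra.
have r2 : 0 < r * r by rewrite mulr_gt0.
rewrite /B; move: h1 h2 h3 r2; rewrite /s; clear; nra.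
Qed.

(** * The descent through isolated points *)

Section Approximation.
Context {R : realType} {J : Type} (a : J -> quat R) (d : J -> R).
Context (d_gt0 : forall j, 0 < d j)
  (d_max : forall P : J -> Prop, (exists j, P j) ->
     exists2 j, P j & forall k, P k -> d k <= d j)
  (sep : forall i j, a i <> a j -> d i * d j <= qdist (a i) (a j) ^+ 2)
  (same : forall i j, a i = a j -> d i = d j)
  (dense : forall z e, 0 < e -> exists j, qdist (a j) z < e /\ d j < e).

(* The constants: 7 makes the balls of two weights in [7 r / 3, 7 r] that come
   within reach of a ball of radius r coincide (comparable_far); 1 / 29 exceeds
   t + t ^ 2 / 5, leaving room around the sphere of radius t d_i for the first ball
   of the descent, while 2 * 7 / 29 < 1 / 2 keeps the next point in the outer half. *)
Definition isolated t i :=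
  forall j, d i < d j -> t * d j + d i / 29%:R <= qdist (a i) (a j).

(** The threshold is proportional to r, so that passing from r to r/3 only brings in the weights
    between 7r/3 and 7r, among which [comparable_far] leaves at most one obstacle. *)
Definition clear t i z r :=
  forall j, a j <> a i -> 7%:R * r <= d j -> t * d j + r <= qdist z (a j).

(** At most one point with weight in the new window is an obstacle, and [rotate_away] evades it. The
    move costs at most 2r/3, so the clearance r from all other points remains at least r/3. *)
Lemma clear_step t i z r : 0 < r -> r <= t * d i / 10%:R ->
  0 <= t <= 2%:R / 59%:R -> qdist z (a i) = t * d i -> clear t i z r ->
  exists z', qdist z' (a i) = t * d i /\ clear t i z' (r / 3%:R).
Proof.
move=> r0 rt t01 zi cl; have /andP[t0 t1] := t01.
have [[j [ji j0 j1 jz]]|nobad] := pselect (exists j, [/\ a j <> a i,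
    7%:R * r / 3%:R <= d j, d j < 7%:R * r & qdist z (a j) < r + t * d j]); last first.
  exists z; split=> // l li lr.
  have [lr'|lr'] := leP (7%:R * r) (d l); first by have := cl l li lr'; lra.
  rewrite leNgt; apply/negP => bad; apply: nobad; exists l; split=> //; lra.
have td : 0 < t * d i by lra.
have zj : qdist z (a j) <= (1 + 7%:R * t) * r.
  have : t * d j <= t * (7%:R * r) by rewrite ler_wpM2l // ltW.
  by lra.
have [z' [z'i zz' z'j]] := rotate_away z (a i) (a j) _ _ _ td r0 rt t01 zi zj.
exists z'; split=> // l li lr.
have tri := qdist_triangle z' z (a l).
have [lr'|lr'] := leP (7%:R * r) (d l); first by have := cl l li lr'; lra.
have [ok|bad] := leP (r + t * d l) (qdist z (a l)); first by lra.
have [aa|ne] := pselect (a j = a l).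
  rewrite -aa; apply: le_trans z'j.
  have : t * d l <= t * (7%:R * r) by rewrite ler_wpM2l // ltW.
  by lra.
have := sep _ _ ne; rewrite leNgt (@comparable_far _ r t) //.
- by rewrite j0 ltW.
- by apply/andP; split; lra.
- rewrite qdist_ge0; have := qdist_triangle z (a j) (a l).
  by rewrite (qdistC (a j) z); lra.
Qed.

(** Any point of the sphere would do. Heavier points are kept off by isolation. An obstacle with 7
    t^2 d_i / 5 <= d_j <= d_i would lie within t (60/59 d_i + d_j) of a_i. The square of this is
    below d_i d_j, since its main term is at most (60/59)^2 (5/7) d_i d_j. *)
Lemma clear_init t i : 0 < t <= 2%:R / 59%:R -> isolated t i ->
  exists z, qdist z (a i) = t * d i /\ clear t i z (t ^+ 2 * d i / 5%:R).
Proof.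
move=> /andP[t0 t1] iso; have di := d_gt0 i.
have td : 0 < t * d i by rewrite mulr_gt0.
exists (qadd (a i) (qscale (t * d i) (qone R))).
set z := qadd _ _.
have zi : qdist z (a i) = t * d i.
  rewrite -[RHS]ger0_norm ?(ltW td) // -sqrtr_sqr; congr (Num.sqrt _).
  by rewrite /qnorm /=; ring.
split=> // j ji dj; rewrite leNgt; apply/negP => bad.
have tri := qdist_triangle z (a i) (a j).
rewrite (qdistC (a i) z) zi in tri.
have tt : t ^+ 2 * d i <= 2%:R / 59%:R * (t * d i).
  by rewrite expr2 -mulrA ler_wpM2r // ltW.
have [ij|ji'] := ltP (d i) (d j).
  have : t * d i <= 2%:R / 59%:R * d i by rewrite ler_wpM2r // ltW.
  have := iso _ ij; lra.
have := sep _ _ (nesym ji).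
pose B := t * d i + t * d j + t ^+ 2 * d i / 5%:R.
have dB : qdist (a i) (a j) <= B by rewrite /B; lra.
rewrite leNgt => /negP; apply.
apply: (@le_lt_trans _ _ (B ^+ 2)).
  by rewrite ler_pXn2r ?nnegrE ?qdist_ge0 // (le_trans (qdist_ge0 _ _) dB).
have BB : B <= t * (60%:R / 59%:R * d i + d j) by rewrite /B; lra.
have B0 : 0 <= B by rewrite (le_trans (qdist_ge0 _ _) dB).
have BB2 : B ^+ 2 <= (t * (60%:R / 59%:R * d i + d j)) ^+ 2.
  by rewrite ler_pXn2r ?nnegrE // (le_trans B0).
apply: le_lt_trans BB2 _.
have dj0 := d_gt0 j.
have p0 : 0 < d i * d j by rewrite mulr_gt0.
have h1 : 7%:R * (t ^+ 2 * d i / 5%:R) * d i <= d j * d i by rewrite ler_pM2r.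
have h2 : d j * d j <= d i * d j by rewrite ler_pM2r.
have h3 : t ^+ 2 * (d i * d j) <= (1 / 29%:R) * (d i * d j).
  rewrite ler_pM2r //; have : t * t <= 1 * t by rewrite ler_pM2r //; lra.
  rewrite expr2; lra.
have h4 : t ^+ 2 * (d j * d j) <= t ^+ 2 * (d i * d j) by rewrite ler_wpM2l ?sqr_ge0.
have -> : (t * (60%:R / 59%:R * d i + d j)) ^+ 2 =
  (60%:R / 59%:R) ^+ 2 * (t ^+ 2 * d i * d i) +
  120%:R / 59%:R * (t ^+ 2 * (d i * d j)) + t ^+ 2 * (d j * d j) by field.
move: h1 h3 h4 p0.
have -> : 7%:R * (t ^+ 2 * d i / 5%:R) * d i = 7%:R / 5%:R * (t ^+ 2 * d i * d i) by field.
by rewrite (mulrC (d j) (d i)); lra.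
Qed.

(** The initial radius t^2 d_i / 5 is below t d_i / 10, so [clear_step] can be iterated, dividing r
    by 3 while z stays on the sphere. *)
Lemma clear_exists t i e : 0 < t <= 2%:R / 59%:R -> 0 < e -> isolated t i ->
  exists z r, [/\ 0 < r, r < e, qdist z (a i) = t * d i & clear t i z r].
Proof.
move=> t01 e0 iso; have [z0 [z0i cl0]] := clear_init _ _ t01 iso.
have /andP[t0 t1] := t01; have di := d_gt0 i.
set r := t ^+ 2 * d i / 5%:R in cl0.
have r0 : 0 < r by rewrite /r divr_gt0 ?mulr_gt0 ?exprn_gt0.
have rt : r <= t * d i / 10%:R.
  have : t ^+ 2 * d i <= 2%:R / 59%:R * (t * d i).
    by rewrite expr2 -mulrA ler_pM2r // mulr_gt0.
  have : 0 < t * d i by rewrite mulr_gt0.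
  by rewrite /r; lra.
have all_n n : exists z, qdist z (a i) = t * d i /\ clear t i z (r / 3%:R ^+ n).
  elim: n => [|n [z [zi cl]]]; first by exists z0; rewrite expr0 divr1.
  rewrite exprSr invfM mulrA; apply: clear_step cl => //.
  - by rewrite divr_gt0 ?exprn_gt0.
  - apply: le_trans rt; rewrite ler_pdivrMr ?exprn_gt0 // ler_peMr ?(ltW r0) //.
    by rewrite exprn_ege1 // ler1n.
  - by rewrite (ltW t0).
have [n rn] := geometric_lt r e 3 isT e0.
have [z [zi cl]] := all_n n; exists z, (r / 3%:R ^+ n); split=> //.
by rewrite divr_gt0 ?exprn_gt0.
Qed.

(** The next point has maximal weight below 7r among those near the outer half of a small clear
    ball. Heavier points are then of three kinds: a_i itself, those of weight at least 7r, which the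
    clear ball excludes, and those excluded by maximality. *)
Lemma isolated_next_pos t i e : 0 < t <= 2%:R / 59%:R -> 0 < e -> isolated t i ->
  exists j, [/\ isolated t j, qdist (a j) (a i) + d j / 29%:R <= (t + e) * d i &
    d j <= d i / 2%:R].
Proof.
move=> t01 e0 iso; have /andP[t0 t1] := t01; have di := d_gt0 i.
have e1 : 0 < Num.min (e * d i) (d i / 14%:R).
  by rewrite lt_min mulr_gt0 // divr_gt0.
have [z [r [r0]]] := clear_exists _ _ _ t01 e1 iso.
rewrite lt_min => /andP[re rd] zi cl.
have td : 0 < t * d i by rewrite mulr_gt0.
(* The point at distance r/2 beyond [z] on the ray from [a i]. *)
pose y := qadd z (qscale (r / 2%:R / (t * d i)) (qsub z (a i))).
have zy : qdist z y = r / 2%:R.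
  have r2 : 0 <= r / 2%:R by lra.
  rewrite -[RHS]ger0_norm // -sqrtr_sqr; congr (Num.sqrt _).
  have -> : qnorm (qsub z y) =
    (r / 2%:R / (t * d i)) ^+ 2 * qnorm (qsub z (a i)) by rewrite /qnorm /=; ring.
  by rewrite -qdist_sq zi -exprMn divfK // gt_eqF.
have yi : qdist y (a i) = t * d i + r / 2%:R.
  have r2 : 0 <= t * d i + r / 2%:R by lra.
  rewrite -[RHS]ger0_norm // -sqrtr_sqr; congr (Num.sqrt _).
  have -> : qnorm (qsub y (a i)) =
    (1 + r / 2%:R / (t * d i)) ^+ 2 * qnorm (qsub z (a i)) by rewrite /qnorm /=; ring.
  by rewrite -qdist_sq zi -exprMn mulrDl mul1r divfK // gt_eqF.
(* The error r/100 fits into the margin 1/2 - 14/29 = 1/58 left when d_j < 7r. *)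
have r100 : 0 < r / 100%:R by lra.
have [k [ky dk]] := dense y _ r100.
(* The second condition is chosen so that a point [l] spoiling the isolation of the maximal [j]
   would itself belong to [T]. *)
pose T j := d j < 7%:R * r /\ qdist (a k) (a j) <= d j / 29%:R.
have [|j [dj kj] jmax] := d_max T.
  by exists k; split; [lra|rewrite qdistxx; have := d_gt0 k; lra].
have dj0 := d_gt0 j.
have yj : qdist y (a j) <= r / 100%:R + d j / 29%:R.
  have := qdist_triangle (a k) y (a j); rewrite (qdistC y (a k)); lra.
exists j; split; last by lra.
- move=> l jl.
  have [li|li] := pselect (a l = a i).
    have := qdist_triangle (a j) y (a i).
    by rewrite yi li (same _ _ li); lra.
  have [lr|lr] := leP (7%:R * r) (d l).
    have := cl l li lr; have := qdist_triangle y z (a l).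
    by have := qdist_triangle (a j) y (a l); lra.
  rewrite leNgt; apply/negP => bad.
  have ne : a j <> a l by move=> /same e'; rewrite e' ltxx in jl.
  have dl0 := d_gt0 l.
  set D := qdist (a j) (a l) in bad.
  have tl : t * d l <= 2%:R / 59%:R * d l by rewrite ler_pM2r.
  have Dl : D <= (2%:R / 59%:R + 1 / 29%:R) * d l by lra.
  have D0 : 0 <= D by exact: qdist_ge0.
  have D2 : D ^+ 2 <= ((2%:R / 59%:R + 1 / 29%:R) * d l) ^+ 2.
    by rewrite ler_pXn2r ?nnegrE // (le_trans D0).
  (* Separation makes d_j tiny against d_l, so that t d_l + 2 d_j / 29 still stays below d_l / 29;
     this uses 2/59 < 1/29. *)
  have jl2 : d j <= (2%:R / 59%:R + 1 / 29%:R) ^+ 2 * d l.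
    rewrite -(ler_pM2r dl0); apply: le_trans (sep _ _ ne) _.
    by apply: le_trans D2 _; rewrite exprMn (expr2 (d l)) mulrA.
  have Tl : T l.
    by split=> //; have := qdist_triangle (a j) (a k) (a l); rewrite -/D; lra.
  by have := jmax l Tl; lra.
- have := qdist_triangle y (a j) (a i); rewrite yi (qdistC (a j) y); lra.
Qed.

(** Separation suffices: the squared distance to a heavier point is at least d_i d_j >= d_i^2. *)
Lemma isolated0 i : isolated 0 i.
Proof.
move=> j ij; have di := d_gt0 i.
have ne : a i <> a j by move=> /same e; rewrite e ltxx in ij.
rewrite mul0r add0r; apply: (@le_trans _ _ (d i)); first by lra.
rewrite -(@ler_pXn2r _ 2) ?nnegrE ?qdist_ge0 ?(ltW di) //.
by apply: le_trans (sep _ _ ne); rewrite expr2 ler_pM2l // ltW.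
Qed.

(** For t = 0 the sphere degenerates to a point, but then every point is isolated and density
    supplies the next one directly. *)
Lemma isolated_next t i e : 0 <= t <= 2%:R / 59%:R -> 0 < e -> isolated t i ->
  exists j, [/\ isolated t j, qdist (a j) (a i) + d j / 29%:R <= (t + e) * d i &
    d j <= d i / 2%:R].
Proof.
move=> /andP[t0 t1] e0; move: t0; rewrite le_eqVlt => /predU1P[<- _|t0]; last first.
  by apply: isolated_next_pos; rewrite ?t0.
have di := d_gt0 i.
have e1 : 0 < Num.min (e * d i / 2%:R) (d i / 2%:R).
  by rewrite lt_min !divr_gt0 ?mulr_gt0.
have [j []] := dense (a i) _ e1; rewrite !lt_min => /andP[j1 j2] /andP[j3 j4].
have dj := d_gt0 j.
by exists j; split; [exact: isolated0|lra|lra].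
Qed.

(** The n-th step of the descent allows the excess e0 / (n + 1) over t and at least halves the
    weight. The limit x inherits the upper bounds from the steps and the lower bounds from the
    isolation of the points c n. *)
Lemma prescribed_approximation t : 0 <= t <= 2%:R / 59%:R ->
  exists x, (forall j, t * d j < qdist x (a j)) /\
    (forall e, 0 < e -> exists j, d j < e /\ qdist x (a j) <= (t + e) * d j).
Proof.
move=> t01; have /andP[t0 t1] := t01.
(* Half the gap between 2/59 and 1/29, so that t + e0 < 1/29 and the balls of radius d (c n) / 29
   are nested. *)
pose e0 : R := (1 / 29%:R - 2%:R / 59%:R) / 2%:R.
have e00 : 0 < e0 by rewrite /e0; lra.
have e01 : 2%:R / 59%:R + e0 < 29%:R^-1 by rewrite /e0; lra.
have [i0 _ i0max] : exists2 j, True & forall k, True -> d k <= d j.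
  apply: (d_max (fun=> True)).
  by have [j _] := dense (qzero R) 1 ltr01; exists j.
pose S := {j | isolated t j}.
have next (x : nat * S) : exists j : S,
    qdist (a (sval j)) (a (sval x.2)) + d (sval j) / 29%:R <=
      (t + e0 / x.1.+1%:R) * d (sval x.2) /\ d (sval j) <= d (sval x.2) / 2%:R.
  case: x => n [i /= iso]; have en : 0 < e0 / n.+1%:R by rewrite divr_gt0.
  by have [j [isoj h1 h2]] := isolated_next _ _ _ t01 en iso; exists (exist _ j isoj).
have [f fP] := choice next.
(* A point of greatest weight is vacuously isolated. *)
have iso0 : isolated t i0 by move=> j; rewrite ltNge i0max.
pose s := fix s n := if n is m.+1 then f (m, s m) else exist _ i0 iso0 : S.
pose c n := sval (s n).
have cS n : qdist (a (c n.+1)) (a (c n)) + d (c n.+1) / 29%:R <=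
  (t + e0 / n.+1%:R) * d (c n) by have [] := fP (n, s n).
have cd n : d (c n.+1) <= d (c n) / 2%:R by have [] := fP (n, s n).
have en0 n : e0 / n.+1%:R <= e0.
  by rewrite ler_pdivrMr // ler_peMr ?ler1n // ltW.
have en n : (t + e0 / n.+1%:R) * d (c n) < d (c n) / 29%:R.
  rewrite mulrC ltr_pM2l //; move: (en0 n) e01; move: (e0 / _) => e1.
  by move: t1; lra.
have cS' n : qdist (a (c n.+1)) (a (c n)) + d (c n.+1) / 29%:R <= d (c n) / 29%:R.
  by apply: le_trans (cS n) (ltW (en n)).
have small n e : 0 < e -> exists k, d (c (n + k)%N) < e.
  move=> e_gt0; have [k dk] := geometric_lt (d (c n)) e 2 isT e_gt0.
  exists k; apply: le_lt_trans dk; elim: k => [|k IH].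
    by rewrite addn0 expr0 divr1.
  by rewrite addnS; apply: le_trans (cd _) _; rewrite exprSr invfM mulrA ler_pM2r.
have far n k :
    qdist (a (c (n + k)%N)) (a (c n)) + d (c (n + k)%N) / 29%:R <= d (c n) / 29%:R.
  elim: k => [|k IH]; first by rewrite addn0 qdistxx add0r.
  rewrite addnS; apply: le_trans IH.
  have := qdist_triangle (a (c (n + k)%N)) (a (c (n + k).+1)) (a (c n)).
  have := cS' (n + k)%N; lra.
have [n|n|x xc] := @nested_balls _ (a \o c) (fun n => d (c n) / 29%:R).
- exact: cS'.
- by rewrite divr_ge0 // ltW.
(* The bound for the next ball passes to the limit: any excess would exceed some later weight, and
   hence the distance from x that [nested_balls] leaves. *)
have xc' n : qdist x (a (c n)) <= (t + e0 / n.+1%:R) * d (c n).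
  move: (cS n); move: (_ * d (c n)) => u cSn.
  rewrite leNgt; apply/negP; rewrite -subr_gt0 => /(small n.+1)[k].
  have := xc (n.+1 + k)%N; have := far n.+1 k => /=.
  have := qdist_triangle (a (c n.+1)) x (a (c n)).
  have := qdist_triangle (a (c (n.+1 + k)%N)) x (a (c n.+1)).
  have := d_gt0 (c (n.+1 + k)%N); lra.
exists x; split.
(* Once d (c k) < d j, the isolation of [c k] keeps a_j away from the ball of radius d (c k) / 29
   that contains x. *)
- move=> j; have [k] := small 0%N _ (d_gt0 j); rewrite add0n => kj.
  have := svalP (s k) j kj; rewrite -/(c k).
  have := le_lt_trans (xc' k) (en k); have := qdist_triangle x (a (c k)) (a j).
  by rewrite (qdistC (a (c k)) x); lra.
- move=> e e_gt0; have [n] := small (Num.bound (e0 / e)) _ e_gt0.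
  set m := (_ + n)%N => dm; exists (c m); split=> //.
  apply: le_trans (xc' m) _; rewrite ler_pM2r // lerD2l ler_pdivrMr //.
  rewrite mulrC -ler_pdivrMr //.
  have /archi_boundP : 0 <= e0 / e by rewrite divr_ge0 // ltW.
  move=> /ltW /le_trans; apply; rewrite ler_nat /m; exact: leq_trans (leq_addr _ _) _.
Qed.



End Approximation.

(** * Norms and traces in an order *)

(** In lowest terms q^n divides D times the n-th power of the numerator, hence divides D. For n = D
    this forces q = 1, as 2^D > D. *)
Lemma rat_int_of_powers (c : rat) (D : nat) : (0 < D)%N ->
  (forall n, D%:R * c ^+ n \is a Num.int) -> c \is a Num.int.
Proof.
move=> D0 Dc.
pose N := `|numq c|%N; pose q := `|denq c|%N.
have dvd n : (q ^ n %| D)%N.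
  have /intrP[m] := Dc n.
  move=> /(congr1 (fun u => u * (denq c)%:~R ^+ n)).
  have XE (i : int) : (i%:~R : rat) ^+ n = (i ^+ n)%:~R by rewrite rmorphXn.
  rewrite -mulrA -exprMn -numqE pmulrn !XE -!intrM.
  move=> /intr_inj /(congr1 absz).
  rewrite !abszM !abszX absz_nat -/N -/q => e.
  rewrite -(@Gauss_dvdl _ _ (N ^ n)%N); first by rewrite e dvdn_mull.
  by rewrite coprimeXl // coprimeXr // coprime_sym coprime_num_den.
have q0 : (0 < q)%N by rewrite absz_gt0 denq_neq0.
have q1 : (q <= 1)%N.
  rewrite leqNgt; apply/negP => q2.
  have := dvdn_leq D0 (dvd D); rewrite leqNgt => /negP; apply.
  exact: ltn_expl.
have /eqP : q = 1%N by apply/eqP; rewrite eqn_leq q1.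
rewrite Qint_def -absz_denq -/q => /eqP ->; exact: eqxx.
Qed.

(** * Coordinates and the rational structure of the algebra *)

Section Algebra.
Context {R : realType} (e0 e1 e2 e3 : quat R).
Context (hA : definite_quat_alg e0 e1 e2 e3).
Local Notation A := (QA e0 e1 e2 e3).

Definition comb (r0 r1 r2 r3 : R) : quat R :=
  qadd (qscale r0 e0) (qadd (qscale r1 e1) (qadd (qscale r2 e2) (qscale r3 e3))).

Definition qrow (x : quat R) : 'rV[R]_4 :=
  \row_j [:: qx1 x; qx2 x; qx3 x; qx4 x]`_j.

Definition basis_mx : 'M[R]_4 :=
  \matrix_i [:: qrow e0; qrow e1; qrow e2; qrow e3]`_i.

Lemma ord4_ind (P : 'I_4 -> Prop) :
  P 0%R -> P 1%R -> P 2%:R -> P 3%:R -> forall i, P i.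
Proof.
move=> P0 P1 P2 P3 [[|[|[|[|i]]]] lti] //.
- by rewrite (_ : Ordinal _ = 0) //; apply: val_inj.
- by rewrite (_ : Ordinal _ = 1) //; apply: val_inj.
- by rewrite (_ : Ordinal _ = 2%:R) //; apply: val_inj.
- by rewrite (_ : Ordinal _ = 3%:R) //; apply: val_inj.
Qed.

Lemma qrow_comb r0 r1 r2 r3 :
  qrow (comb r0 r1 r2 r3) = (\row_i [:: r0; r1; r2; r3]`_i) *m basis_mx.
Proof.
apply/rowP => j; rewrite !mxE !big_ord_recl big_ord0 !mxE /=.
by elim/ord4_ind: j; rewrite /= addr0.
Qed.

Lemma qrow_inj : injective qrow.
Proof.
move=> x y /rowP e; apply: quatP.
- by have := e 0; rewrite !mxE.
- by have := e 1; rewrite !mxE.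
- by have := e 2%:R; rewrite !mxE.
- by have := e 3%:R; rewrite !mxE.
Qed.

Lemma row4E (v : 'rV[R]_4) :
  v = \row_i [:: v 0 0; v 0 1; v 0 2%:R; v 0 3%:R]`_i.
Proof. by apply/rowP; elim/ord4_ind; rewrite mxE. Qed.

Lemma basis_mx_unit : basis_mx \in unitmx.
Proof.
rewrite -row_free_unit; apply: inj_row_free => v.
rewrite (row4E v) -qrow_comb => v0.
have [_ _ /(_ (v 0 0) (v 0 1) (v 0 2%:R) (v 0 3%:R))] := hA.
case; first by apply: qrow_inj; rewrite v0; apply/rowP; elim/ord4_ind; rewrite !mxE.
by move=> -> -> -> ->; apply/rowP; elim/ord4_ind; rewrite !mxE.
Qed.

Lemma spanning x : exists r0 r1 r2 r3, x = comb r0 r1 r2 r3.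
Proof.
pose v := qrow x *m invmx basis_mx.
exists (v 0 0), (v 0 1), (v 0 2%:R), (v 0 3%:R); apply: qrow_inj.
by rewrite qrow_comb -row4E mulmxKV ?basis_mx_unit.
Qed.

Lemma QA_basis : [/\ A e0, A e1, A e2 & A e3].
Proof.
have e (b0 b1 b2 b3 : bool) : A (comb b0%:R b1%:R b2%:R b3%:R).
  by exists b0%:R, b1%:R, b2%:R, b3%:R; rewrite !ratr_nat.
split.
- have := e true false false false; congr (A _); apply: quatP => /=; ring.
- have := e false true false false; congr (A _); apply: quatP => /=; ring.
- have := e false false true false; congr (A _); apply: quatP => /=; ring.
- have := e false false false true; congr (A _); apply: quatP => /=; ring.
Qed.

(* [4 Re x] is the trace of left multiplication by [x], computed in the rational
   basis [e0, ..., e3]. *)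
Lemma QA_rational_re x : A x -> exists c : rat, qx1 x = ratr c.
Proof.
move=> Ax; have [_ AM _] := hA; have [A0 A1 A2 A3] := QA_basis.
have [c00 [c01 [c02 [c03 x0]]]] := AM _ _ Ax A0.
have [c10 [c11 [c12 [c13 x1]]]] := AM _ _ Ax A1.
have [c20 [c21 [c22 [c23 x2]]]] := AM _ _ Ax A2.
have [c30 [c31 [c32 [c33 x3]]]] := AM _ _ Ax A3.
pose L : 'M[R]_4 := \matrix_i
  [:: qrow x; qrow (qmul x (Quat 0 1 0 0)); qrow (qmul x (Quat 0 0 1 0));
      qrow (qmul x (Quat 0 0 0 1))]`_i.
have LE y : qrow (qmul x y) = qrow y *m L.
  apply/rowP => j; rewrite !mxE !big_ord_recl big_ord0 !mxE /=.
  by elim/ord4_ind: j; rewrite /=; ring.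
pose C : 'M[R]_4 := \matrix_i
  [:: \row_j [:: ratr c00; ratr c01; ratr c02; ratr c03]`_j;
      \row_j [:: ratr c10; ratr c11; ratr c12; ratr c13]`_j;
      \row_j [:: ratr c20; ratr c21; ratr c22; ratr c23]`_j;
      \row_j [:: ratr c30; ratr c31; ratr c32; ratr c33]`_j]`_i.
(* [L] and [C] are the matrices of left multiplication by [x], acting on rows, in the bases 1, i, j,
   k and e0, ..., e3; being conjugate, they have the same trace. *)
have EL : basis_mx *m L = C *m basis_mx.
  apply/row_matrixP; elim/ord4_ind; rewrite !row_mul !rowK /= -LE.
  - by rewrite x0 qrow_comb.
  - by rewrite x1 qrow_comb.
  - by rewrite x2 qrow_comb.
  - by rewrite x3 qrow_comb.
have trL : \tr L = 4%:R * qx1 x.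
  by rewrite /mxtrace !big_ord_recl big_ord0 !mxE /= ?mxE /=; ring.
have trC : \tr C = ratr (c00 + c11 + c22 + c33).
  by rewrite /mxtrace !big_ord_recl big_ord0 !mxE /= !rmorphD /=; ring.
have : \tr L = \tr C.
  rewrite -[L](mulKmx basis_mx_unit) EL mxtrace_mulC mulmxK ?basis_mx_unit //.
rewrite trL trC => e.
exists ((c00 + c11 + c22 + c33) / 4%:R).
by rewrite fmorph_div /= -e ratr_nat [RHS]mulrC mulKf ?pnatr_eq0.
Qed.

End Algebra.

Lemma denq_ratr {R : realType} (c : rat) :
  (`|denq c|%N)%:R * ratr c = (numq c)%:~R :> R.
Proof.
by rewrite -[RHS]ratr_int numqE rmorphM /= ratr_int mulrC pmulrn absz_denq.
Qed.

(** * Integrality and denominators in an order *)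

Section Order.
Context {R : realType} (e0 e1 e2 e3 : quat R).
Context (hA : definite_quat_alg e0 e1 e2 e3).
Local Notation A := (QA e0 e1 e2 e3).
Context (O : set (quat R)) (hO : is_order A O).

Lemma order1 : O (qone R).
Proof. by case: hO => _ []. Qed.

Lemma orderD x y : O x -> O y -> O (qadd x y).
Proof. by case: hO => _ [_ [h _]]; exact: h. Qed.

Lemma orderN x : O x -> O (qopp x).
Proof. by case: hO => _ [_ [_ [h _]]]; exact: h. Qed.

Lemma orderM x y : O x -> O y -> O (qmul x y).
Proof. by case: hO => _ [_ [_ [_ [h _]]]]; exact: h. Qed.

Lemma order0 : O (qzero R).
Proof.
rewrite (_ : qzero R = qadd (qone R) (qopp (qone R))).
  by apply: orderD; rewrite ?orderN; [exact: order1|exact/orderN/order1].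
by apply: quatP => /=; ring.
Qed.

Lemma orderZ (c : R) x : c \is a Num.int -> O x -> O (qscale c x).
Proof.
have nat_scale n y : O y -> O (qscale n%:R y).
  move=> Oy; elim: n => [|n IH]; first by rewrite qscale0; exact: order0.
  rewrite (_ : qscale _ _ = qadd y (qscale n%:R y)); first exact: orderD.
  by apply: quatP => /=; rewrite -natr1; ring.
move=> /intrP[[n|n] ->] Ox; first exact: nat_scale.
rewrite NegzE mulrNz (_ : qscale _ _ = qopp (qscale n.+1%:R x)).
  exact/orderN/nat_scale.
by apply: quatP => /=; ring.
Qed.

Lemma order_gens : exists gens : seq (quat R), (forall g, List.In g gens -> O g) /\
  forall x, O x -> exists2 cs : seq int, size cs = size gens & x = zcomb (zip cs gens).
Proof.
case: hO => _ [_ [_ [_ [_ [[gens hg] _]]]]]; exists gens; split; last first.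
  by move=> x /hg[cs [? ?]]; exists cs.
have zero_comb (l : seq (quat R)) : zcomb (zip (nseq (size l) 0) l) = qzero R.
  elim: l => //= y l ->; rewrite qscale0; by apply: quatP => /=; rewrite addr0.
move=> g gin; apply/hg; elim: gens {hg} gin => //= y l IH [<-|/IH[cs [sz ->]]].
- exists (1 :: nseq (size l) 0); rewrite /= size_nseq zero_comb; split=> //.
  by apply: quatP => /=; rewrite mul1r addr0.
- exists (0 :: cs); rewrite /= sz; split=> //.
  by apply: quatP => /=; rewrite mul0r add0r.
Qed.

Lemma order_rational_re x : O x -> exists c : rat, qx1 x = ratr c.
Proof. by move=> Ox; apply: QA_rational_re hA _ _; case: hO => OA _; apply: OA. Qed.

(** The product of the denominators of the real parts of finitely many generators serves for all
    integral combinations. *)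
Lemma order_re_denominator : exists2 D : nat, (0 < D)%N &
  forall x, O x -> D%:R * qx1 x \is a Num.int.
Proof.
have [gens [gO gx]] := order_gens.
suff [D D0 h] : exists2 D : nat, (0 < D)%N & forall cs : seq int,
    D%:R * qx1 (zcomb (zip cs gens)) \is a Num.int.
  by exists D => // x /gx[cs _ ->]; apply: h.
elim: gens gO {gx} => [|g l IH] gO.
  by exists 1%N => // cs; case: cs => [|? ?] /=; rewrite mulr0.
have [|D D0 hD] := IH; first by move=> y yl; apply: gO; right.
have [c gc] := order_rational_re _ (gO g (or_introl erefl)).
pose q := `|denq c|%N.
have qc := @denq_ratr R c; rewrite -/q in qc.
exists (q * D)%N; first by rewrite muln_gt0 D0 absz_gt0 denq_neq0.
move=> [|i cs] /=; first by rewrite mulr0.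
have -> : (q * D)%:R * (i%:~R * qx1 g + qx1 (zcomb (zip cs l))) =
   D%:R * i%:~R * (q%:R * qx1 g) + q%:R * (D%:R * qx1 (zcomb (zip cs l))) :> R.
  by rewrite natrM; ring.
rewrite gc qc; apply: rpredD; apply: rpredM => //.
- by apply: rpredM; [exact: natr_int|exact: intr_int].
- exact: intr_int.
- exact: natr_int.
Qed.

(** The real part of x^2 - 2 Re(x) x + N(x) = 0. It reduces denominators of norms to those of real
    parts of elements of the order. *)
Lemma qnorm_re (x : quat R) : qnorm x = 2%:R * qx1 x ^+ 2 - qx1 (qmul x x).
Proof. rewrite /qnorm /=; ring. Qed.

(* The powers of [x] stay in [O], where norms have bounded denominators. *)
Lemma order_norm_int x : O x -> qnorm x \is a Num.int.
Proof.
have [D D0 hD] := order_re_denominator.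
have hN y : O y -> (D ^ 2)%:R * qnorm y \is a Num.int.
  move=> Oy; have -> : (D ^ 2)%:R * qnorm y =
      2%:R * (D%:R * qx1 y) ^+ 2 - D%:R * (D%:R * qx1 (qmul y y)).
    by rewrite qnorm_re natrX; ring.
  apply: rpredB; apply: rpredM; rewrite ?natr_int //; first by apply/rpredX/hD.
  exact/hD/orderM.
move=> Ox; have [c xc] : exists c : rat, qnorm x = ratr c.
  have [a xa] := order_rational_re _ Ox.
  have [b xb] := order_rational_re _ (orderM _ _ Ox Ox).
  exists (2%:R * a ^+ 2 - b).
  by rewrite qnorm_re xa xb rmorphB rmorphM /= rmorphXn ratr_nat.
have pw n : exists2 y, O y & qnorm y = qnorm x ^+ n.
  elim: n => [|n [y Oy yn]]; first by exists (qone R); [exact: order1|rewrite qnorm1].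
  by exists (qmul x y); [exact: orderM|rewrite qnormM yn exprS].
suff /intrP[m cm] : c \is a Num.int by rewrite xc cm ratr_int intr_int.
apply: (@rat_int_of_powers _ (D ^ 2)%N); first by rewrite expn_gt0 D0.
move=> n; have [y Oy yn] := pw n.
have /intrP[m hm] := hN y Oy; apply/intrP; exists m.
apply: (fmorph_inj (@ratr R)); rewrite /= ratr_int -hm yn xc.
by rewrite rmorphM /= ratr_nat rmorphXn.
Qed.

Lemma order_trace_int x : O x -> 2%:R * qx1 x \is a Num.int.
Proof.
move=> Ox; have -> : 2%:R * qx1 x = qnorm (qadd (qone R) x) - 1 - qnorm x.
  by rewrite /qnorm /=; ring.
by rewrite !rpredB ?rpred1 // order_norm_int //; apply/orderD/Ox/order1.
Qed.

Lemma orderC x : O x -> O (qconj x).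
Proof.
move=> Ox; have -> : qconj x = qadd (qscale (2%:R * qx1 x) (qone R)) (qopp x).
  by apply: quatP => /=; ring.
apply: orderD; last exact: orderN.
by apply: orderZ; [exact: order_trace_int|exact: order1].
Qed.

Lemma order_norm_ge1 x : O x -> x <> qzero R -> 1 <= qnorm x.
Proof.
move=> Ox /qnorm_gt0; have /intrP[m ->] := order_norm_int _ Ox.
by rewrite ltr0z ler1z gtz0_ge1.
Qed.

Lemma QA_denominator x : A x -> exists2 m : nat, (0 < m)%N & O (qscale m%:R x).
Proof.
case: hO => _ [_ [_ [_ [_ [_ h]]]]] /h[l [lO ->]] {h x}.
elim: l lO => [|[c y] l IH] lO /=.
  exists 1%N => //; rewrite (_ : qscale _ _ = qzero R); first exact: order0.
  by apply: quatP => /=; ring.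
have [|m m0 Om] := IH; first by move=> p pl; apply: lO; right.
have Oy : O y by apply: (lO (c, y)); left.
pose q := `|denq c|%N.
have qc := @denq_ratr R c; rewrite -/q in qc.
exists (q * m)%N; first by rewrite muln_gt0 m0 absz_gt0 denq_neq0.
have -> : qscale (q * m)%:R (qadd (qscale (ratr c) y) (qcomb l)) =
  qadd (qscale (m%:R * (q%:R * ratr c)) y) (qscale q%:R (qscale m%:R (qcomb l))).
  by apply: quatP => /=; rewrite natrM; ring.
apply: orderD; last by apply: orderZ => //; exact: natr_int.
by apply: orderZ => //; rewrite qc rpredM ?natr_int ?intr_int.
Qed.

Lemma qnorm_sqrtD (x y : quat R) :
  Num.sqrt (qnorm (qadd x y)) <= Num.sqrt (qnorm x) + Num.sqrt (qnorm y).
Proof.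
have := qdist_triangle y (qadd x y) (qzero R); rewrite /qdist.
have -> : qsub (qadd x y) (qzero R) = qadd x y by apply: quatP => /=; ring.
have -> : qsub (qadd x y) y = x by apply: quatP => /=; ring.
by have -> : qsub y (qzero R) = y by apply: quatP => /=; ring.
Qed.

(** Integer multiples of e0, ..., e3 in the order span a full lattice. Rounding coordinates down
    leaves an error of at most the sum of the lengths of its generators. *)
Lemma order_cobounded : exists B : R, forall x, exists2 y, O y & qdist y x <= B.
Proof.
have [A0 A1 A2 A3] := QA_basis e0 e1 e2 e3.
have [m0 m00 O0] := QA_denominator _ A0; have [m1 m10 O1] := QA_denominator _ A1.
have [m2 m20 O2] := QA_denominator _ A2; have [m3 m30 O3] := QA_denominator _ A3.
pose L x := Num.sqrt (@qnorm R x).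
pose f0 := qscale m0%:R e0; pose f1 := qscale m1%:R e1.
pose f2 := qscale m2%:R e2; pose f3 := qscale m3%:R e3.
exists (L f0 + (L f1 + (L f2 + L f3))) => x.
have [r0 [r1 [r2 [r3 ->]]]] := spanning _ _ _ _ hA x.
pose fl (r : R) : R := (Num.floor r)%:~R.
have flI r : fl r \is a Num.int by exact: intr_int.
pose s0 := r0 / m0%:R; pose s1 := r1 / m1%:R.
pose s2 := r2 / m2%:R; pose s3 := r3 / m3%:R.
exists (qadd (qscale (fl s0) f0) (qadd (qscale (fl s1) f1)
  (qadd (qscale (fl s2) f2) (qscale (fl s3) f3)))).
  by do !apply: orderD; apply: orderZ.
rewrite qdistC /qdist.
have -> : qsub (comb e0 e1 e2 e3 r0 r1 r2 r3) (qadd (qscale (fl s0) f0)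
    (qadd (qscale (fl s1) f1) (qadd (qscale (fl s2) f2) (qscale (fl s3) f3)))) =
  qadd (qscale (s0 - fl s0) f0) (qadd (qscale (s1 - fl s1) f1)
    (qadd (qscale (s2 - fl s2) f2) (qscale (s3 - fl s3) f3))).
  by apply: quatP => /=; rewrite /s0 /s1 /s2 /s3; field; rewrite !pnatr_eq0 -!lt0n; apply/and4P.
have Lfl s f : L (qscale (s - fl s) f) <= L f.
  rewrite /L; apply: ler_wsqrtr; rewrite qnormZ ler_piMl ?qnorm_ge0 //.
  have := floor_le s; have := floorD1_gt s; rewrite intrD -/(fl s) => h1 h2.
  by rewrite exprn_ile1 ?subr_ge0 // lerBlDl ltW.
by do 3!(apply: le_trans (qnorm_sqrtD _ _) _; apply: lerD; first exact: Lfl); exact: Lfl.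
Qed.

End Order.

(** * Admissible fractions *)

Section Admissible.
Context {R : realType} (e0 e1 e2 e3 : quat R).
Context (hA : definite_quat_alg e0 e1 e2 e3).
Local Notation A := (QA e0 e1 e2 e3).
Context (O I : set (quat R)) (hO : is_order A O) (hI : is_nz_twosided_ideal O I).

Lemma admissible_neq0 p q : admissible O I p q -> qnorm q != 0.
Proof.
move=> [_ _ [r [s [_ [_ rs]]]]]; apply/eqP => q0.
(* [qinv] sends 0 to 0, so for q = 0 both terms of the determinant vanish and its norm could not be
   1. *)
move: rs; rewrite /qinv q0 invr0 (qnorm_eq0 _ q0).
rewrite (_ : qnorm _ = 0); first by move/esym/eqP; rewrite oner_eq0.
by rewrite /qnorm /=; ring.
Qed.

(* The second row [(X, Y)] of the inverse of the matrix with columns [(p, q)] and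
   [(r, s)], whose reduced norm is 1. *)
Lemma admissible_row p q : admissible O I p q ->
  exists X Y, [/\ O X, O Y, qnorm X = qnorm q,
    qadd (qmul X p) (qmul Y q) = qzero R &
    exists r s, [/\ O r, O s & qadd (qmul X r) (qmul Y s) = qone R]].
Proof.
move=> adm; have q0 := admissible_neq0 _ _ adm.
have [Op Iq [r [s [Or [Os rs]]]]] := adm.
have Oq : O q by case: hI => IO _; apply: IO.
have OC := orderC _ _ _ _ hA _ hO; have OM := orderM _ _ _ _ _ hO.
have OD := orderD _ _ _ _ _ hO; have ON := orderN _ _ _ _ _ hO.
have OZ := orderZ _ _ _ _ _ hO; have Nint := order_norm_int _ _ _ _ hA _ hO.
pose X := qadd (qscale (qnorm q) (qconj r)) (qopp (qmul (qmul (qconj s) q) (qconj p))).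
pose Y := qadd (qscale (qnorm p) (qconj s)) (qopp (qmul (qmul (qconj r) p) (qconj q))).
(* The norm of the Dieudonné determinant, written without q^-1. The same expression is N(X) / N(q)
   and the real part of X r + Y s. *)
have rs' : qnorm q * qnorm r + qnorm p * qnorm s
    - 2%:R * qx1 (qmul (qmul (qconj r) p) (qmul (qconj q) s)) = 1.
  rewrite -[RHS]rs.
  have -> : qnorm (qsub (qmul q r) (qmul (qmul (qmul q p) (qinv q)) s)) =
    qnorm q * qnorm r + qnorm q * qnorm p * qnorm s * (qnorm q)^-1 ^+ 2 * qnorm q
    - 2%:R * (qnorm q)^-1 * qnorm q *
      qx1 (qmul (qmul (qconj r) p) (qmul (qconj q) s)).
    by rewrite /qinv; move: (qnorm q)^-1 => u; rewrite /qnorm /=; ring.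
  by field.
have XE : qnorm X = qnorm q.
  rewrite -[RHS]mulr1 -[X in _ = _ * X]rs' /X /qnorm /=; ring.
exists X, Y; split=> //.
- by apply: OD; [apply: OZ; auto|apply: ON; auto].
- by apply: OD; [apply: OZ; auto|apply: ON; auto].
- by apply: quatP; rewrite /X /Y /qnorm /=; ring.
exists r, s; split=> //.
apply: quatP; last 3 first.
- by rewrite /X /Y /qnorm /=; ring.
- by rewrite /X /Y /qnorm /=; ring.
- by rewrite /X /Y /qnorm /=; ring.
by rewrite [RHS]/= -[RHS]rs' /X /Y /qnorm /=; ring.
Qed.

Definition fraction (p q : quat R) := qmul p (qinv q).

(** The relation gives Y = - X p q^-1, hence X z + Y = X (z - p q^-1). *)
Lemma qdist_fraction p q X Y z : qnorm q != 0 -> qnorm X = qnorm q ->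
  qadd (qmul X p) (qmul Y q) = qzero R ->
  qnorm (qadd (qmul X z) Y) = qnorm q * qdist z (fraction p q) ^+ 2.
Proof.
move=> q0 Xq XY; rewrite qdist_sq -Xq -qnormM; congr qnorm.
have Yq : Y = qopp (qmul (qmul X p) (qinv q)).
  rewrite -[LHS]qmulq1 -(qmulV _ q0) qmulA.
  have -> : qmul Y q = qopp (qmul X p).
    by have := XY; move: (qmul X p) (qmul Y q) => [? ? ? ?] [? ? ? ?] [] /= /eqP;
      rewrite addrC addr_eq0 => /eqP-> /eqP; rewrite addrC addr_eq0 => /eqP-> /eqP;
      rewrite addrC addr_eq0 => /eqP-> /eqP; rewrite addrC addr_eq0 => /eqP->.
  by apply: quatP => /=; ring.
rewrite {1}Yq -qmulA /fraction; move: (qmul p _) => f.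
by apply: quatP => /=; ring.
Qed.

(** The element X p' + Y q' of the order is non-zero, so its norm, N(q) N(q') times the squared
    distance, is at least 1. *)
Lemma admissible_sep p q p' q' : admissible O I p q -> admissible O I p' q' ->
  fraction p q <> fraction p' q' ->
  (qnorm q)^-1 * (qnorm q')^-1 <= qdist (fraction p q) (fraction p' q') ^+ 2.
Proof.
move=> adm adm' ne.
have q0 := admissible_neq0 _ _ adm; have q0' := admissible_neq0 _ _ adm'.
have qp : 0 < qnorm q by rewrite lt0r q0 qnorm_ge0.
have qp' : 0 < qnorm q' by rewrite lt0r q0' qnorm_ge0.
have [X [Y [OX OY Xq XY _]]] := admissible_row _ _ adm.
have Op' : O p' by case: adm'.
have Oq' : O q' by case: hI => IO _; apply: IO; case: adm'.
pose v := qadd (qmul X p') (qmul Y q').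
have Ov : O v by apply: (orderD _ _ _ _ _ hO); apply: (orderM _ _ _ _ _ hO).
have vE : v = qmul (qadd (qmul X (fraction p' q')) Y) q'.
  by rewrite qmulDl -qmulA -qmulA qmulVx // qmulq1.
have vN : qnorm v = qnorm q * qnorm q' * qdist (fraction p q) (fraction p' q') ^+ 2.
  by rewrite vE qnormM (qdist_fraction _ _ _ _ _ q0 Xq XY) qdistC; ring.
have v1 : 1 <= qnorm v.
  apply: (order_norm_ge1 _ _ _ _ hA _ hO) => // v0; apply: ne.
  apply: qdist_eq0; apply/eqP; have /eqP := vN.
  by rewrite v0 qnorm0 eq_sym !mulf_eq0 (negPf q0) (negPf q0') !orbb.
by rewrite -invfM -[leLHS]mulr1 ler_pdivrMl ?mulr_gt0 // -vN.
Qed.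

(** By symmetry the weight depends only on the fraction f. If (r, s) completes (p', q'), then X r +
    Y s = X (r - f s) is a non-zero element of the order of norm N(q) / N(q'), so this ratio is at
    least 1. *)
Lemma admissible_norm_le p q p' q' : admissible O I p q -> admissible O I p' q' ->
  fraction p q = fraction p' q' -> qnorm q' <= qnorm q.
Proof.
move=> adm adm' eqf.
have q0 := admissible_neq0 _ _ adm; have q0' := admissible_neq0 _ _ adm'.
have [X [Y [OX OY Xq XY _]]] := admissible_row _ _ adm.
have [X' [Y' [OX' OY' Xq' XY' [r [s [Or Os rs]]]]]] := admissible_row _ _ adm'.
have zero P Q U V : qnorm Q != 0 -> qnorm U = qnorm Q ->
    qadd (qmul U P) (qmul V Q) = qzero R -> V = qopp (qmul U (fraction P Q)).
  move=> Q0 UQ UV.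
  have /qnorm_eq0 : qnorm (qadd (qmul U (fraction P Q)) V) = 0.
    by rewrite (qdist_fraction _ _ _ _ _ Q0 UQ UV) qdistxx expr0n mulr0.
  by move: (qmul U _) V {UV} => [? ? ? ?] [? ? ? ?] [] /= /eqP;
      rewrite addrC addr_eq0 => /eqP-> /eqP; rewrite addrC addr_eq0 => /eqP-> /eqP;
      rewrite addrC addr_eq0 => /eqP-> /eqP; rewrite addrC addr_eq0 => /eqP->.
have YE := zero _ _ _ _ q0 Xq XY; have YE' := zero _ _ _ _ q0' Xq' XY'.
rewrite -eqf in YE'.
pose w := qsub r (qmul (fraction p q) s).
have w1 : qmul X' w = qone R by rewrite -rs YE'; apply: quatP => /=; ring.
pose v := qadd (qmul X r) (qmul Y s).
have vE : v = qmul X w by rewrite /v YE; apply: quatP => /=; ring.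
have Ov : O v by apply: (orderD _ _ _ _ _ hO); apply: (orderM _ _ _ _ _ hO).
have wq : qnorm q' * qnorm w = 1 by rewrite -Xq' -qnormM w1 qnorm1.
have v1 : 1 <= qnorm v.
  apply: (order_norm_ge1 _ _ _ _ hA _ hO) => // v0.
  have /eqP := congr1 (@qnorm R) v0; rewrite vE qnormM qnorm0 mulf_eq0 Xq (negPf q0) /=.
  by move=> /eqP w0; move: wq; rewrite w0 mulr0 => /eqP; rewrite eq_sym oner_eq0.
have qp' : 0 <= qnorm q' by exact: qnorm_ge0.
have := ler_wpM2l qp' v1; rewrite vE qnormM Xq mulr1.
by rewrite (mulrC (qnorm q)) mulrA wq mul1r.
Qed.

(** If m x lies in the order, so does m (X x + Y), whose norm is m^2 N(q) times the squared
    distance. Distances of order N(q)^-1 are thus impossible for large N(q). *)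
Lemma QA_not_close x : A x -> exists2 c : R, 0 < c & forall p q, admissible O I p q ->
  x <> fraction p q -> c * (qnorm q)^-1 <= qdist x (fraction p q) ^+ 2.
Proof.
move=> Ax; have [m m0 Om] := QA_denominator _ _ _ _ _ hO _ Ax.
have mp : 0 < m%:R :> R by rewrite ltr0n.
exists ((m%:R ^+ 2)^-1); first by rewrite invr_gt0 exprn_gt0.
move=> p q adm ne; have q0 := admissible_neq0 _ _ adm.
have qp : 0 < qnorm q by rewrite lt0r q0 qnorm_ge0.
have [X [Y [OX OY Xq XY _]]] := admissible_row _ _ adm.
pose v := qadd (qmul X (qscale m%:R x)) (qscale m%:R Y).
have Ov : O v.
  apply: (orderD _ _ _ _ _ hO); first exact: (orderM _ _ _ _ _ hO).
  by apply: (orderZ _ _ _ _ _ hO) => //; exact: natr_int.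
have vN : qnorm v = m%:R ^+ 2 * qnorm q * qdist x (fraction p q) ^+ 2.
  rewrite -mulrA -(qdist_fraction _ _ _ _ _ q0 Xq XY) -qnormZ; congr qnorm.
  by apply: quatP => /=; ring.
have v1 : 1 <= qnorm v.
  apply: (order_norm_ge1 _ _ _ _ hA _ hO) => // v0; apply: ne.
  apply: qdist_eq0; apply/eqP; have /eqP := vN.
  by rewrite v0 qnorm0 eq_sym !mulf_eq0 (negPf q0) (gt_eqF mp) !orbb.
have mq : 0 < m%:R ^+ 2 * qnorm q by rewrite mulr_gt0 ?exprn_gt0.
by rewrite -invfM -[leLHS]mulr1 ler_pdivrMl // -vN.
Qed.

(** For m in the ideal and o in the order, p = 1 + m o has norm congruent to 1 modulo m, hence prime
    to q = m^k; a Bezout relation between integers gives r and s. *)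
Lemma admissible_dense z e : 0 < e -> exists p q, [/\ admissible O I p q,
  qdist (fraction p q) z < e & (qnorm q)^-1 < e].
Proof.
move=> e_gt0.
have OZ := orderZ _ _ _ _ _ hO; have OM := orderM _ _ _ _ _ hO.
have OD := orderD _ _ _ _ _ hO; have O1 := order1 _ _ _ _ _ hO.
have OC := orderC _ _ _ _ hA _ hO; have Nint := order_norm_int _ _ _ _ hA _ hO.
have [IO [I0 [ID [IN [IM [x [Ix xn0]]]]]]] := hI.
have [n xn] : exists n : nat, qnorm x = n%:R.
  have /natrP[n ->] : qnorm x \is a Num.nat by rewrite natrEint Nint ?qnorm_ge0 //; apply: IO.
  by exists n.
have n0 : (0 < n)%N by rewrite -(ltr0n R) -xn qnorm_gt0.
(* A multiple of the norm n of an element of the ideal, hence in the ideal; the factor 2 ensures m >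
   1, so that powers of m grow. *)
pose m : R := (2 * n)%:R.
have m2 : (1 < 2 * n)%N by rewrite (leq_trans _ (leq_pmulr _ n0)).
have mint : m \is a Num.int by exact: natr_int.
have m0 : 0 < m by rewrite ltr0n (ltn_trans _ m2).
have Im : I (qscale m (qone R)).
  have -> : qscale m (qone R) = qmul (qscale 2%:R (qone R)) (qmul x (qconj x)).
    by rewrite qmulxC xn; apply: quatP => /=; rewrite /m natrM; ring.
  apply: (IM _ _ _ _).1; first by apply: OZ => //; exact: natr_int.
  by apply: (IM _ _ _ _).2 => //; apply/OC/IO.
have [B hB] := order_cobounded _ _ _ _ hA _ hO.
have [k1 hk1] := geometric_lt B e _ m2 e_gt0.
have [k2 hk2] := geometric_lt 1 e _ m2 e_gt0.
rewrite -/m in hk1 hk2.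
have m1 : 1 <= m by rewrite ler1n ltnW.
(* The extra factor m puts q in the ideal; the remaining M = m^(k-1) is the scale of the
   approximation. *)
pose k := (maxn k1 k2).+1.
have B0 : 0 <= B by have [y _] := hB z; apply: le_trans; exact: qdist_ge0.
have kk1 : m ^+ k1 <= m ^+ (maxn k1 k2) by rewrite ler_weXn2l // leq_maxl.
have kk2 : m ^+ k2 <= m ^+ (maxn k1 k2) by rewrite ler_weXn2l // leq_maxr.
pose M := m ^+ (maxn k1 k2).
have M0 : 0 < M by rewrite exprn_gt0.
have hM1 : B / M < e.
  apply: le_lt_trans hk1; rewrite ler_wpM2l // lef_pV2 // posrE exprn_gt0 //.
have hM2 : M^-1 < e.
  apply: le_lt_trans hk2; rewrite div1r lef_pV2 // posrE exprn_gt0 //.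
(* Since p q^-1 = (o + 1/m) / M, the element [o] has to approximate M z - 1/m. *)
have [o Oo ho] := hB (qadd (qscale M z) (qscale (- m^-1) (qone R))).
pose p := qadd (qone R) (qscale m o).
pose q := qscale (m ^+ k) (qone R).
have qN : qnorm q = (m ^+ k) ^+ 2 by rewrite qnormZ qnorm1 mulr1.
have mk0 : m ^+ k != 0 by rewrite gt_eqF ?exprn_gt0.
have qV : qinv q = qscale (m ^+ k)^-1 (qone R).
  by rewrite /qinv qN; apply: quatP => /=; field.
pose t := 2%:R * qx1 o + m * qnorm o.
have tint : t \is a Num.int.
  apply: rpredD; first exact: (order_trace_int _ _ _ _ hA _ hO).
  by apply: rpredM => //; apply: Nint.
have pN : qnorm p = 1 + m * t by rewrite /t /p /qnorm /=; ring.
(* A truncated geometric series, which inverts N(p) = 1 + m t modulo m^k. *)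
pose S := \sum_(i < k) (- (m * t)) ^+ i.
have Sint : S \is a Num.int by rewrite rpred_sum // => i _; rewrite rpredX // rpredN rpredM.
have bez : m ^+ k * (- t) ^+ k + qnorm p * S = 1.
  rewrite pN -exprMn mulrN; have := subrX1 (- (m * t)) k; rewrite -/S => h.
  have -> : (1 + m * t) * S = - ((- (m * t) - 1) * S) by ring.
  by rewrite -h; ring.
have Op : O p by apply: OD => //; apply: OZ.
exists p, q; split.
- split=> //.
    have -> : q = qmul (qscale (m ^+ (maxn k1 k2)) (qone R)) (qscale m (qone R)).
      by apply: quatP => /=; rewrite exprSr; ring.
    by apply: (IM _ _ _ _).1 => //; apply: OZ => //; rewrite rpredX.
  (* As q is a real scalar, q p q^-1 = p and the determinant becomes m^k (-t)^k + N(p) S = 1. *)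
  exists (qscale ((- t) ^+ k) (qone R)), (qscale (- S) (qconj p)).
  split; [|split].
  + by apply: OZ => //; rewrite rpredX // rpredN.
  + by apply: OZ; [rewrite rpredN|apply: OC].
  + rewrite qV (_ : qsub _ _ = qscale (m ^+ k * (- t) ^+ k + qnorm p * S) (qone R)).
      by rewrite bez qscale1 qnorm1.
    have qpq : qmul (qmul q p) (qscale (m ^+ k)^-1 (qone R)) = p.
      by apply: quatP => /=; field.
    by rewrite qpq; apply: quatP; rewrite /qnorm /=; ring.
- have -> : qdist (fraction p q) z =
    Num.sqrt ((M^-1) ^+ 2 * qnorm (qsub o (qadd (qscale M z) (qscale (- m^-1) (qone R))))).
    rewrite /qdist -qnormZ; congr (Num.sqrt (qnorm _)).
    rewrite /fraction qV /k exprS -/M.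
    by apply: quatP => /=; field; rewrite pnatr_eq0 -lt0n n0 gt_eqF.
  rewrite sqrtrM ?sqr_ge0 // sqrtr_sqr gtr0_norm ?invr_gt0 // -/(qdist _ _) mulrC.
  by apply: le_lt_trans hM1; rewrite ler_pM2r ?invr_gt0.
- apply: le_lt_trans hM2; rewrite qN lef_pV2 ?posrE ?exprn_gt0 //.
  rewrite -exprM; apply: ler_weXn2l => //.
  exact: leq_trans (leqnSn _) (leq_pmulr _ _).
Qed.

End Admissible.

(** * The interval in the spectrum *)

Theorem theorem6p11 (R : realType) (e0 e1 e2 e3 : quat R)
  (hA : definite_quat_alg e0 e1 e2 e3)
  (O I : set (quat R))
  (hO : is_order (QA e0 e1 e2 e3) O)
  (hI : is_nz_twosided_ideal O I) :
  forall t : R, 0 <= t <= 337%:R / 10000%:R ->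
    exists x : quat R, ~ QA e0 e1 e2 e3 x /\ cval O I x = t%:E.
Proof.
move=> t /andP[t0 t1].
(* 337 * 59 = 19883 <= 20000. *)
have t01 : 0 <= t <= 2%:R / 59%:R.
  by rewrite t0 (le_trans t1) // ler_pdivrMr // mulrAC ler_pdivlMr // -!natrM ler_nat.
pose J := {pq : quat R * quat R | admissible O I pq.1 pq.2}.
pose a (j : J) := fraction (sval j).1 (sval j).2.
pose d (j : J) := (qnorm (sval j).2)^-1.
have adm (j : J) : admissible O I (sval j).1 (sval j).2 by exact: svalP j.
have N0 (j : J) : 0 < qnorm (sval j).2.
  by rewrite lt0r (admissible_neq0 _ _ _ _ (adm j)) qnorm_ge0.
have d_gt0 (j : J) : 0 < d j by rewrite invr_gt0.
have Nnat (j : J) : exists n : nat, qnorm (sval j).2 = n%:R.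
  apply/natrP; rewrite natrEint qnorm_ge0 andbT.
  apply: (order_norm_int _ _ _ _ hA _ hO).
  by case: hI => IO _; apply: IO; case: (adm j).
(* The norms of the denominators are natural numbers, so a least one exists in each non-empty
   family. *)
have d_max (P : J -> Prop) : (exists j, P j) ->
    exists2 j, P j & forall k, P k -> d k <= d j.
  move=> [j Pj]; have [n jn] := Nnat j.
  pose Q n := `[< exists2 k, P k & qnorm (sval k).2 = n%:R >].
  have exQ : exists n, Q n by exists n; apply/asboolP; exists j.
  case: (ex_minnP exQ) => m /asboolP[k Pk km] mmin; exists k => // l Pl.
  have [n' ln] := Nnat l.
  rewrite /d lef_pV2 ?posrE // km ln ler_nat; apply: mmin.
  by apply/asboolP; exists l.
have sep (i j : J) : a i <> a j -> d i * d j <= qdist (a i) (a j) ^+ 2.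
  by apply: (admissible_sep _ _ _ _ hA _ _ hO hI).
have same (i j : J) : a i = a j -> d i = d j.
  have le := admissible_norm_le _ _ _ _ hA _ _ hO hI.
  move=> e; congr (_^-1); apply/eqP; rewrite eq_le.
  by rewrite (le _ _ _ _ (adm j) (adm i)) //= (le _ _ _ _ (adm i) (adm j)).
have dense z e : 0 < e -> exists j : J, qdist (a j) z < e /\ d j < e.
  move=> /(admissible_dense _ _ _ _ hA _ _ hO hI z)[p [q [pq h1 h2]]].
  by exists (exist _ (p, q) pq).
have [x [xfar xnear]] := prescribed_approximation a d d_gt0 d_max sep same dense _ t01.
exists x; split.
(* Were x in the algebra, an approximation with d_j < c / (t + 1)^2 would have squared distance at
   most (t + 1)^2 d_j^2 < c d_j. *)
- move=> /(QA_not_close _ _ _ _ hA _ _ hO hI)[c c0 hc].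
  have t1_gt0 : 0 < t + 1 by rewrite ltr_wpDl.
  have e_gt0 : 0 < Num.min 1 (c / (t + 1) ^+ 2).
    by rewrite lt_min ltr01 divr_gt0 ?exprn_gt0.
  have [j []] := xnear _ e_gt0; rewrite lt_min => /andP[_ dj].
  have dj0 := d_gt0 j; have far := xfar j => near.
  have {}near : qdist x (a j) <= (t + 1) * d j.
    by apply: le_trans near _; rewrite ler_pM2r // lerD2l ge_min lexx.
  have xj : x <> a j.
    move=> xj; move: far; rewrite -xj qdistxx ltNge.
    by rewrite mulr_ge0 // ltW.
  have := hc _ _ (adm j) xj; rewrite -/(d j) -/(a j) leNgt => /negP; apply.
  apply: (@le_lt_trans _ _ (((t + 1) * d j) ^+ 2)).
    by rewrite ler_pXn2r ?nnegrE ?qdist_ge0 // mulr_ge0 // ltW.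
  rewrite exprMn (expr2 (d j)) mulrA ltr_pM2r // mulrC -ltr_pdivlMr //.
  by rewrite exprn_gt0.
- apply: le_anti; apply/andP; split; last first.
    (* M = 0 suffices for the lower bound, which holds for every admissible pair. *)
    apply: le_ereal_sup_tmp; eexists; first by exists 0; reflexivity.
    apply: le_ereal_inf_tmp => _ [p [q [pq [_ ->]]]]; rewrite lee_fin.
    have := xfar (exist _ (p, q) pq); rewrite /d /a /= -/(fraction p q) -/(qdist _ _).
    have q0 : 0 < qnorm q := N0 (exist _ (p, q) pq).
    by rewrite ltr_pdivrMr // mulrC => /ltW.
  apply: ge_ereal_sup => _ [M ->]; apply/lee_addgt0Pr => e e_gt0.
  (* A weight below (|M| + 1)^-1 forces N(q) >= M. *)
  have e'_gt0 : 0 < Num.min e (`|M| + 1)^-1.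
    by rewrite lt_min e_gt0 invr_gt0 ltr_wpDl.
  have [j []] := xnear _ e'_gt0; rewrite lt_min => /andP[_ dj] near.
  apply: ge_ereal_inf; eexists.
    exists (sval j).1, (sval j).2; split; first exact: adm.
    split; last by reflexivity.
    have M1 : 0 < `|M| + 1 by rewrite ltr_wpDl.
    move: dj; rewrite ltf_pV2 ?posrE // => /ltW; apply: le_trans.
    by apply: le_trans (ler_norm M) _; rewrite lerDl.
  rewrite -/(fraction _ _) -/(a j) -/(qdist _ _) -EFinD lee_fin.
  rewrite mulrC -ler_pdivlMr //; apply: le_trans near _.
  by rewrite ler_pM2r // lerD2l ge_min lexx.
Qed.
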